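(* For non-clairvoyant DAG scheduling on related machines, every non-clairvoyant algorithm has competitive ratio $\Omega\!\left(\frac{\log m}{\log\log m}\right)$, where $m$ is the number of machines.
   Context: DAG scheduling on related machines: there are $m$ machines, machine $i$ having speed $s_i>0$. Each job $j$ has a weight $w_j$ and consists of a set of tasks with processing requirements $p_v\ge0$, together with a directed acyclic graph of precedence constraints on its tasks: a task may be processed only after all its predecessors have finished. Tasks may be preempted and migrated; a task runs on at most one machine at a time, and different tasks may run concurrently on different machines; a machine of speed $s$ running a task for $\varepsilon$ time does $s\varepsilon$ units of processing on it. A job completes when all its tasks have finished; the objective is the weighted sum of job completion times. Non-clairvoyance: the algorithm knows the jobs and their DAGs but learns a task's processing requirement only when the task finishes. The competitive ratio is the supremum over instances of the ratio between the algorithm's objective and the optimal offline objective on the same machines. *)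

(* Defs.v *)
From HB Require Import structures.
From mathcomp Require Import all_boot all_order all_algebra.
From mathcomp Require Import all_classical all_reals all_analysis.
Set Implicit Arguments.
Unset Strict Implicit.
Unset Printing Implicit Defensive.
Import Order.TTheory GRing.Theory Num.Theory.
Import numFieldNormedType.Exports.
Local Open Scope classical_set_scope.
Local Open Scope ring_scope.

(* The part of an instance that is revealed to the algorithm at the start:
   everything except the processing requirements. *)
Record instance (R : realType) (m : nat) := Instance {
  speed : 'I_m -> R;
  speed_gt0 : forall i, 0 < speed i;
  job : finType;
  weight : job -> R;
  weight_ge0 : forall j, 0 <= weight j;
  task : finType;
  job_of : task -> job;
  (* [prec u v]: v may be processed only after u has finished *)
  prec : rel task;
  prec_acyclic : forall s : seq task, s != [::] -> ~~ cycle prec s;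
  prec_job : forall u v, prec u v -> job_of u = job_of v }.

Definition requirements R m (I : instance R m) := task I -> {nonneg R}.

(* [S t i] is the task run by machine i at time t, if any. A machine assigned
   to an already finished task is in effect idle. *)
Definition schedule R m (I : instance R m) := R -> 'I_m -> option (task I).

Section Schedules.
Context {R : realType} {m : nat} (I : instance R m).
Implicit Types (p : requirements I) (S : schedule I).

Definition run_times S (i : 'I_m) (v : task I) (t : R) : set R :=
  [set x | 0 <= x <= t /\ S x i = Some v].

(* Amount of processing that v has received up to time t. *)
Definition processed S (v : task I) (t : R) : R :=
  \sum_(i < m) speed I i * fine (lebesgue_measure (run_times S i v t)).

(* [connect] is the reflexive transitive closure. The ancestors of v matter
   only for tasks with requirement 0, which finish as soon as all their
   predecessors have; a task with positive requirement receives no processing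
   before its ancestors have finished. *)
Definition finished p S (v : task I) (t : R) : Prop :=
  forall u, connect (@prec R m I) u v -> (p u)%:num <= processed S u t.

Definition completion p S (v : task I) : \bar R :=
  ereal_inf [set t%:E | t in [set t : R | 0 <= t /\ finished p S v t]].

Definition job_completion p S (j : job I) : \bar R :=
  \big[maxe/0%E]_(v | job_of v == j) completion p S v.

Definition objective p S : \bar R :=
  (\sum_j (weight j)%:E * job_completion p S j)%E.

Record feasible p S : Prop := Feasible {
  feasible_measurable : forall i v t, measurable (run_times S i v t);
  feasible_one_machine : forall t i i' v, 0 <= t ->
    S t i = Some v -> S t i' = Some v -> i = i';
  feasible_prec : forall t i u v, 0 <= t ->
    S t i = Some v -> prec u v -> (completion p S u <= t%:E)%E;
  feasible_finite : forall v, (completion p S v < +oo)%E }.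

Definition opt p : \bar R := ereal_inf [set objective p S | S in feasible p].

(* What has been revealed about task v by time t: nothing if v is unfinished,
   its completion time and processing requirement otherwise. *)
Definition observed p S (t : R) (v : task I) : option (\bar R * {nonneg R}) :=
  if (completion p S v <= t%:E)%E then Some (completion p S v, p v) else None.

End Schedules.

(* A deterministic non-clairvoyant algorithm for m machines, given by the
   schedules it produces. By [nc_causal], the assignment at time t is a
   function of t, the initially known data and the observations up to time t. *)
Record nc_algorithm (R : realType) (m : nat) := NCAlgorithm {
  nc_schedule :> forall I : instance R m, requirements I -> schedule I;
  nc_feasible : forall (I : instance R m) (p : requirements I),
    feasible p (nc_schedule p);
  nc_causal : forall (I : instance R m) (p q : requirements I) (t : R),
    0 <= t ->
    (forall v, observed p (nc_schedule p) t v
             = observed q (nc_schedule q) t v) ->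
    forall i, nc_schedule p t i = nc_schedule q t i }.

(* In \bar R, 0 / 0 = 0 and x / 0 = +oo for x > 0. *)
Definition competitive_ratio (R : realType) (m : nat) (A : nc_algorithm R m)
    : \bar R :=
  ereal_sup [set r : \bar R | exists (I : instance R m) (p : requirements I),
    r = (objective p (A I p) / opt p)%E].

(* Main.v *)
(* One job, no precedence constraints, m tasks and m machines, where about 4^j
   machines have speed 2^-j. The requirements are a permutation of the speeds,
   so OPT <= 1. The adversary lets all unfinished tasks look alike and, each
   time one of them completes, raises the requirement of the others to the next
   speed in increasing order. Hence when the tasks of size 2^-(j+1) are done,
   no task of size 2^-j has received more than 2^-(j+1). The remaining work of
   the 3 * 4^j tasks of size 2^-j is then 3/2 * 2^j, while the faster and equal
   machines process them at rate at most 6 * 2^j, and the slower ones, at most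
   one per task, at rate at most 3/2 * 2^j. So each of the log_4 m sizes costs
   the algorithm time at least 1/5. *)
Require Import Defs.
From mathcomp Require Import all_boot all_order all_algebra.
From mathcomp Require Import all_classical all_reals all_analysis.
From mathcomp Require Import zify ring lra.
Import Order.TTheory GRing.Theory Num.Theory.
Local Open Scope classical_set_scope.
Local Open Scope ring_scope.

(** * Measures of sets of times *)

Lemma lebesgue_measure_le_itv (R : realType) (F : set R) (a b : R) :
  a <= b -> measurable F -> F `<=` `[a, b] ->
  (lebesgue_measure F <= (b - a)%:E)%E.
Proof.
move=> ab mF Fab.
have <- : lebesgue_measure `[a, b] = (b - a)%:E.
  rewrite lebesgue_measure_itv/= lte_fin; case: ltP => // ba.
  by rewrite (le_anti (introT andP (conj ab ba))) subrr.
by apply: le_measure => //; rewrite inE; [exact: mF | exact: measurable_itv].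
Qed.

(** Disjointness is only asked for within [P]: replacing the other sets by [set0] makes the whole
    family disjoint, and additivity applies to the union. *)
Lemma sum_fine_measure_le (R : realType) (J : finType) (P : pred J)
    (F : J -> set R) (a b : R) :
  a <= b -> (forall j, measurable (F j)) ->
  (forall j, F j `<=` `[a, b]) ->
  (forall i j x, P i -> P j -> F i x -> F j x -> i = j) ->
  \sum_(j | P j) fine (lebesgue_measure (F j)) <= b - a.
Proof.
move=> ab mF Fab tF.
pose G j := if P j then F j else set0.
have mG j : measurable (G j) by rewrite /G; case: ifP.
have Gab j : G j `<=` `[a, b].
  by rewrite /G; case: ifP => _; [exact: Fab | exact: sub0set].
have Gfin j : lebesgue_measure (G j) \is a fin_num.
  rewrite ge0_fin_numE//.
  exact: le_lt_trans (lebesgue_measure_le_itv _ _ _ _ ab (mG j) (Gab j)) (ltry _).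
have -> : \sum_(j | P j) fine (lebesgue_measure (F j)) =
    \sum_j fine (lebesgue_measure (G j)).
  rewrite big_mkcond/=; apply: eq_bigr => j _.
  by rewrite /G; case: ifP => // _; rewrite measure0.
rewrite sum_fine//.
have <- : lebesgue_measure (\bigcup_(j in [set` index_enum J]) G j) =
    (\sum_j lebesgue_measure (G j))%E.
  rewrite fsbig_seq ?index_enum_uniq// measure_fin_bigcup//;
    last by move=> i _; exact: mG.
  move=> i j _ _ [x []]; rewrite /G.
  by case: ifP => // Pi; case: ifP => // Pj; exact: tF.
have mU : measurable (\bigcup_(j in [set` index_enum J]) G j).
  by apply: fin_bigcup_measurable.
have le : (lebesgue_measure (\bigcup_(j in [set` index_enum J]) G j)
    <= (b - a)%:E)%E.
  by apply: lebesgue_measure_le_itv => // x [j _]; exact: Gab.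
rewrite -lee_fin fineK// ge0_fin_numE//.
exact: le_lt_trans le (ltry _).
Qed.

(** * Amounts of processing under a feasible schedule *)

Section Processing.
Context {R : realType} {m : nat} {I : instance R m}.
Variables (p : requirements I) (S : schedule I).
Hypothesis feas : feasible p S.

(** For [0 <= a] these are the times in []a, b]] at which [i] runs [v]. *)
Let work i v (a b : R) : set R := run_times S i v b `\` run_times S i v a.

Let workP i v a b x : 0 <= a -> work i v a b x -> a < x <= b /\ S x i = Some v.
Proof.
move=> a0 [[/andP[x0 xb] Sx] nx]; split=> //; rewrite xb andbT ltNge.
by apply/negP => xa; apply: nx; split; rewrite ?x0.
Qed.

Let measurable_work i v a b : measurable (work i v a b).
Proof. by apply: measurableD; exact: (feasible_measurable feas). Qed.

Let processedB v a b : 0 <= a <= b -> processed S v b - processed S v a =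
  \sum_(i < m) speed I i * fine (lebesgue_measure (work i v a b)).
Proof.
move=> /andP[a0 ab]; rewrite /processed -sumrB; apply: eq_bigr => i _.
rewrite -mulrBr; congr (_ * _).
have mr t := feasible_measurable feas i v t.
have fin t : (lebesgue_measure (run_times S i v t) < +oo)%E.
  have [t0|t0] := leP 0 t.
    apply: le_lt_trans (ltry (t - 0)); apply: lebesgue_measure_le_itv => //.
    by move=> x [] /=; rewrite in_itv/=.
  rewrite (_ : run_times S i v t = set0) ?measure0 ?ltry//.
  apply/seteqP; split=> // x [/andP[x0 xt] _].
  by have := le_lt_trans (le_trans x0 xt) t0; rewrite ltxx.
have sub : run_times S i v a `<=` run_times S i v b.
  by move=> x [/andP[x0 xa] Sx]; split; rewrite ?x0 ?(le_trans xa ab).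
rewrite /work measureD ?setIidr//; [|exact: mr|exact: mr|exact: fin].
by rewrite fineB ?ge0_fin_numE ?fin.
Qed.

Lemma processed0 v : processed S v 0 = 0.
Proof.
rewrite /processed big1// => i _.
rewrite (_ : lebesgue_measure _ = 0%E) ?mulr0//.
apply/eqP; rewrite eq_le measure_ge0 andbT.
have := lebesgue_measure_le_itv R (run_times S i v 0) 0 0.
rewrite subrr; apply=> //; first exact: (feasible_measurable feas).
by move=> x [x0 _] /=; rewrite in_itv.
Qed.

Lemma processed_mono v a b : 0 <= a -> a <= b -> processed S v a <= processed S v b.
Proof.
move=> a0 ab; rewrite -subr_ge0 processedB ?a0//; apply: sumr_ge0 => i _.
by rewrite mulr_ge0 ?fine_ge0// ltW// speed_gt0.
Qed.

(* A machine runs at most one task at a time, and a task runs on at most one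
   machine at a time: the first bounds the contribution of the machines in H,
   the second that of the remaining, slower ones. *)
Lemma processed_capacity (L : {set task I}) (H : {set 'I_m}) (s a b : R) :
  0 <= a <= b -> 0 <= s -> (forall i, i \notin H -> speed I i <= s) ->
  \sum_(v in L) (processed S v b - processed S v a) <=
    (b - a) * (\sum_(i in H) speed I i + #|L|%:R * s).
Proof.
move=> aab s0 slow; have /andP[a0 ab] := aab.
under eq_bigr => v _ do rewrite processedB// (bigID [in H])/=.
rewrite big_split/= mulrDr; apply: lerD.
  rewrite exchange_big/= mulr_sumr; apply: ler_sum => i _.
  rewrite -mulr_sumr mulrC ler_wpM2r ?(ltW (speed_gt0 _ _))//.
  apply: sum_fine_measure_le => //.
    by move=> v x /(workP _ _ _ _ _ a0)[/andP[ax xb] _] /=; rewrite in_itv/= xb ltW.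
  move=> v w x _ _ /(workP _ _ _ _ _ a0)[_ Sv] /(workP _ _ _ _ _ a0)[_ Sw].
  by move: Sw; rewrite Sv => -[].
rewrite mulrCA -sum1_card natr_sum mulr_suml.
apply: ler_sum => v _; rewrite mul1r.
apply: (@le_trans _ _ (\sum_(i | i \notin H)
    s * fine (lebesgue_measure (work i v a b)))).
  by apply: ler_sum => i iH; rewrite ler_wpM2r ?fine_ge0 ?slow.
rewrite -mulr_sumr mulrC ler_wpM2r//; apply: sum_fine_measure_le => //.
  by move=> i x /(workP _ _ _ _ _ a0)[/andP[ax xb] _] /=; rewrite in_itv/= xb ltW.
move=> i j x _ _ /(workP _ _ _ _ _ a0)[/andP[ax _] Si] /(workP _ _ _ _ _ a0)[_ Sj].
by apply: (feasible_one_machine feas) Si Sj; exact: le_trans (ltW ax).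
Qed.

Lemma processed_lipschitz v a b : 0 <= a <= b ->
  processed S v b <= processed S v a + (b - a) * \sum_i speed I i.
Proof.
move=> aab.
(* With every machine in [H] the slow bound is vacuous, so [s] can be 0. *)
have := @processed_capacity [set v]%SET [set: 'I_m]%SET 0 a b aab (lexx 0).
rewrite big_set1 mulr0 addr0 (eq_bigl predT) => [|i]; last by rewrite inE.
rewrite lerBlDl; apply=> i; by rewrite inE.
Qed.

End Processing.

(** * Continuity of processing and completion times *)

Section Completion.
Context {R : realType} {m : nat} {I : instance R m}.
Variables (p : requirements I) (S : schedule I).
Hypothesis feas : feasible p S.

Lemma processed_unif_continuous (e : R) : 0 < e -> exists2 d : R, 0 < d &
  forall v a b, 0 <= a <= b -> b - a <= d -> processed S v b <= processed S v a + e.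
Proof.
move=> e0; pose L := \sum_i speed I i.
have L0 : 0 <= L by apply: sumr_ge0 => i _; exact: ltW (speed_gt0 _ _).
have L1 : 0 < L + 1 by rewrite ltr_wpDl.
(* [L] is 0 when there is no machine; adding 1 keeps the modulus positive. *)
exists (e / (L + 1)) => [|v a b aab bad]; first exact: divr_gt0.
apply: le_trans (processed_lipschitz p S feas v a b aab) _; rewrite lerD2l.
apply: le_trans (ler_wpM2r L0 bad) _.
by rewrite -mulrA ler_piMr ?(ltW e0)// mulrC ler_pdivrMr// mul1r lerDl.
Qed.

Lemma processed_left_continuous v (t e : R) : 0 < t -> 0 < e ->
  exists2 s, 0 <= s < t & processed S v t <= processed S v s + e.
Proof.
move=> t0 /processed_unif_continuous[d d0 hd].
have [dt|td] := leP d t.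
  exists (t - d); first by rewrite subr_ge0 dt ltrBlDr ltrDl.
  by apply: hd; [rewrite subr_ge0 dt lerBlDr lerDl ltW | rewrite subKr].
by exists 0; rewrite ?lexx//; apply: hd; rewrite ?subr0 ?lexx ltW.
Qed.

Hypothesis noprec : forall u v : task I, ~~ prec u v.

Lemma finishedE v t : finished p S v t <-> (p v)%:num <= processed S v t.
Proof.
split=> [|h u /connectP[[|w s] /=]]; first by apply; exact: connect0.
  by move=> _ <-.
by rewrite (negbTE (noprec _ _)).
Qed.

(** The infimum is attained: [v] is finished at times at most [t] or arbitrarily little after it,
    and continuity brings the inequality back to [t]. *)
Lemma completion_leE v (t : R) : 0 <= t ->
  (completion p S v <= t%:E)%E = ((p v)%:num <= processed S v t).
Proof.
move=> t0; apply/idP/idP => [le_ct|done].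
  apply/ler_addgt0Pr => e e0.
  have [d d0 hd] := processed_unif_continuous e e0.
  have : (completion p S v < (t + d)%:E)%E.
    by apply: le_lt_trans le_ct _; rewrite lte_fin ltrDl.
  move=> /ereal_inf_lt[_ [s [s0 /finishedE fs] <-]]; rewrite lte_fin => sd.
  apply: le_trans fs _; have [st|ts] := leP s t.
    apply: le_trans (processed_mono p S feas v s t s0 st) _.
    by rewrite lerDl ltW.
  by apply: hd; rewrite ?t0 ?(ltW ts)// lerBlDl ltW.
by apply: ereal_inf_lbound; exists t => //; split => //; exact/finishedE.
Qed.

Definition completion_time v : R := fine (completion p S v).

Lemma completion_ge0 v : (0 <= completion p S v)%E.
Proof. by apply: le_ereal_inf_tmp => _ [t [t0 _] <-]; rewrite lee_fin. Qed.

Lemma completion_timeE v : completion p S v = (completion_time v)%:E.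
Proof.
rewrite fineK// ge0_fin_numE ?completion_ge0//; exact: (feasible_finite feas).
Qed.

Lemma completion_time_ge0 v : 0 <= completion_time v.
Proof. by rewrite fine_ge0 ?completion_ge0. Qed.

Lemma completion_time_leE v (t : R) : 0 <= t ->
  (completion_time v <= t) = ((p v)%:num <= processed S v t).
Proof. by move=> t0; rewrite -completion_leE// completion_timeE lee_fin. Qed.

(** Before its completion [v] has received less than [p v]; left continuity carries the bound to the
    completion time. *)
Lemma processed_completion_le v : processed S v (completion_time v) <= (p v)%:num.
Proof.
have := completion_time_ge0 v; rewrite le_eqVlt => /predU1P[<-|c0].
  by rewrite (processed0 p S feas).
apply/ler_addgt0Pr => e e0.
have [s /andP[s0 sc] hs] := processed_left_continuous v _ e c0 e0.
apply: le_trans hs _; rewrite lerD2r.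
have := completion_time_leE v s s0; rewrite leNgt sc/= => /esym/negbT.
by rewrite -ltNge => /ltW.
Qed.

End Completion.

(** Agreement strictly before [T] is enough to reach [T] itself, by left continuity of both
    amounts. *)
Lemma eq_processed (R : realType) m (I : instance R m) (p q : requirements I)
    (S S' : schedule I) (T : R) :
  feasible p S -> feasible q S' ->
  (forall t i, 0 <= t < T -> S t i = S' t i) ->
  forall v t, 0 <= t <= T -> processed S v t = processed S' v t.
Proof.
move=> feasS feasS' SS' v.
have lt_eq t : t < T -> processed S v t = processed S' v t.
  move=> tT; apply: eq_bigr => i _.
  congr (_ * fine (lebesgue_measure _)).
  apply/seteqP; split=> x [/andP[x0 xt] Sx]; split; rewrite ?x0 ?xt//;
    by rewrite -Sx SS' ?x0 ?(le_lt_trans xt).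
move=> t /andP[]; rewrite le_eqVlt => /predU1P[<- _|t0 tT].
  by rewrite (processed0 p S feasS) (processed0 q S' feasS').
apply: le_anti; apply/andP; split; apply/ler_addgt0Pr => e e0.
  have [s /andP[s0 st] hs] := processed_left_continuous p S feasS v t e t0 e0.
  rewrite (le_trans hs)// lerD2r lt_eq ?(lt_le_trans st)//.
  by rewrite (processed_mono q S' feasS')// ltW.
have [s /andP[s0 st] hs] := processed_left_continuous q S' feasS' v t e t0 e0.
rewrite (le_trans hs)// lerD2r -lt_eq ?(lt_le_trans st)//.
by rewrite (processed_mono p S feasS)// ltW.
Qed.

(** * Runs that a non-clairvoyant algorithm cannot distinguish *)

Section Adversary.
Context {R : realType} {m : nat} (A : nc_algorithm R m) {I : instance R m}.
Hypothesis noprec : forall u v : task I, ~~ prec u v.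
Implicit Types p q : requirements I.

Let ctime p v := completion_time p (A I p) v.
Let proc p v t := processed (A I p) v t.

(* Consider the first completion that differs between the two runs: before it
   the observations agree, hence so do the schedules and the amounts processed
   up to and including that moment, so the completion occurs in both runs. *)
Lemma nc_agree p q (T : R) :
  (forall v, p v = q v \/ (p v)%:num <= (q v)%:num /\ T <= ctime p v) ->
  forall t i, 0 <= t < T -> A I p t i = A I q t i.
Proof.
move=> pq.
pose bad v := (ctime p v != ctime q v) || (p v != q v).
pose e v := Num.min (ctime p v) (ctime q v).
(* Before the first bad event a good task is observed alike in both runs and a bad one in neither,
   so causality applies. *)
have agree c : (forall v, bad v -> c <= e v) ->
    forall t i, 0 <= t < c -> A I p t i = A I q t i.
  move=> ce t i /andP[t0 tc]; apply: nc_causal => // v.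
  rewrite /observed !(completion_timeE _ _ (nc_feasible A _)) !lee_fin.
  have [/ce|] := boolP (bad v).
    rewrite le_min => /andP[cp cq].
    by rewrite !leNgt !(lt_le_trans tc).
  by rewrite negb_or !negbK => /andP[/eqP cpq /eqP ->]; rewrite -/(ctime p v) cpq.
have [/existsP[v0 /andP[bad0 e0]]|] := boolP [exists v, bad v && (e v < T)];
    last first.
  rewrite negb_exists => /forallP h; apply: agree => v bv.
  by have := h v; rewrite bv/= -leNgt.
exfalso; case: (arg_minP e bad0) => v bv emin.
have evT : e v < T by apply: le_lt_trans (emin _ bad0) e0.
have ev0 : 0 <= e v by rewrite le_min !completion_time_ge0.
have := eq_processed _ _ _ p q _ _ (e v) (nc_feasible A p) (nc_feasible A q)
  (agree _ emin) v (e v).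
rewrite ev0 lexx => /(_ isT) procE.
have cp := completion_time_leE p _ (nc_feasible A p) noprec v _ ev0.
have cq := completion_time_leE q _ (nc_feasible A q) noprec v _ ev0.
have le_e : (ctime p v <= e v) || (ctime q v <= e v) by rewrite -ge_min.
(* A completion in the [q] run forces one in the [p] run, since [p v <= q v] and both have processed
   the same amount. *)
have le_pe : ctime p v <= e v.
  case/orP: le_e => // le_q.
  rewrite cp procE; have [->|[h _]] := pq v; first by rewrite -cq.
  by apply: le_trans h _; rewrite -cq.
(* A raised requirement contradicts [e v < T]; an unchanged one makes both completions equal to
   [e v], so [v] is not bad. *)
have [pqv|[_ Tp]] := pq v; last first.
  by have := le_lt_trans (le_trans Tp le_pe) evT; rewrite ltxx.
have le_qe : ctime q v <= e v by rewrite cq -procE -pqv -cp.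
move: bv; rewrite /bad pqv eqxx orbF => /negP; apply; apply/eqP.
move: le_pe le_qe; rewrite !le_min => /andP[_ h1] /andP[h2 _].
by apply: le_anti; rewrite h1.
Qed.


(** * Raising requirements in the order of completion *)

Variable a : nat -> {nonneg R}.
Hypothesis a_mono : forall i j, (i <= j)%N -> (a i)%:num <= (a j)%:num.

(* A task outside s has index [size s]: all these tasks look alike. *)
Definition ranked_requirements (s : seq (task I)) : requirements I :=
  fun v => a (index v s).

(** A task outside [s] has index [size s], so it can be [w] but never [u]: the tasks of [s] complete
    in this order and no later than all others. *)
Definition ranked_run (s : seq (task I)) := let p := ranked_requirements s in
  forall u w, (index u s < index w s)%N ->
    ctime p u <= ctime p w /\ proc p w (ctime p u) <= (p u)%:num.

(** Appending [v] raises the requirement of the tasks still outside from [a (size s)] to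
    [a (size s).+1], which the algorithm cannot notice before [v] completes. *)
Lemma ranked_run_rcons (s : seq (task I)) v : v \notin s ->
  (forall w, w \notin s ->
    ctime (ranked_requirements s) v <= ctime (ranked_requirements s) w) ->
  ranked_run s -> ranked_run (rcons s v).
Proof.
set p := ranked_requirements s => vs vmin run q u w uw; rewrite -/q.
have index_in x : x \in s -> index x (rcons s v) = index x s.
  by move=> xs; rewrite -cats1 index_cat xs.
have index_v : index v (rcons s v) = size s.
  by rewrite -cats1 index_cat (negbTE vs)/= eqxx addn0.
have index_out x : x \notin s -> x != v -> index x (rcons s v) = (size s).+1.
  by move=> xs xv; rewrite -cats1 index_cat (negbTE xs)/= eq_sym (negbTE xv) addn1.
have pqv : p v = q v by rewrite /p /q /ranked_requirements index_v memNindex.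
have pqs x : x \in s -> p x = q x.
  by move=> xs; rewrite /p /q /ranked_requirements index_in.
have pqN x : x \notin s -> (p x)%:num <= (q x)%:num.
  have [->|xv xs] := eqVneq x v; first by rewrite pqv.
  by rewrite /p /q /ranked_requirements index_out// memNindex// a_mono.
have pq_le x : (p x)%:num <= (q x)%:num.
  by have [/pqs ->|/pqN] := boolP (x \in s).
have cp0 x : 0 <= ctime p x by exact: completion_time_ge0.
have cq0 x : 0 <= ctime q x by exact: completion_time_ge0.
have cpE x t : 0 <= t -> (ctime p x <= t) = ((p x)%:num <= proc p x t).
  by move=> t0; exact: (completion_time_leE _ _ (nc_feasible A p)).
have cqE x t : 0 <= t -> (ctime q x <= t) = ((q x)%:num <= proc q x t).
  by move=> t0; exact: (completion_time_leE _ _ (nc_feasible A q)).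
(* Every raised task lies outside [s], so by the choice of [v] it completes no earlier than [v] in
   the [p] run. *)
have procE x t : 0 <= t <= ctime p v -> proc p x t = proc q x t.
  apply: (eq_processed _ _ _ p q _ _ _ (nc_feasible A p) (nc_feasible A q)).
  apply: nc_agree => x'; have [/pqs|xs] := boolP (x' \in s); first by left.
  by right; rewrite pqN// vmin.
have ctimeE x : p x = q x -> ctime p x <= ctime p v -> ctime q x = ctime p x.
  move=> pqx le_v; have le_x : ctime q x <= ctime p x.
    by rewrite cqE// -procE ?cp0// -pqx -cpE.
  apply: le_anti; rewrite le_x/= cpE// procE ?cq0 ?(le_trans le_x)//.
  by rewrite pqx -cqE.
have late x t : 0 <= t <= ctime p v -> ctime q x <= t -> ctime p x <= t.
  move=> /[dup] /andP[t0 tv] tt; rewrite cqE// cpE// procE//.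
  exact: le_trans (pq_le x).
(* Up to the completion of [v] the runs coincide, so the claim can be checked in the [p] run; by
   [late], [w] cannot complete before [u] in the [q] run only. *)
suff [uv pqu cuw puw] : [/\ ctime p u <= ctime p v, p u = q u,
    ctime p u <= ctime p w & proc p w (ctime p u) <= (p u)%:num].
  rewrite ctimeE// -procE ?cp0// -pqu; split=> //.
  rewrite leNgt; apply/negP => wu.
  have := late w (ctime q w); rewrite cq0 lexx (le_trans (ltW wu))//.
  by move=> /(_ isT isT) /(le_trans cuw); rewrite leNgt wu.
have [us|us] := boolP (u \in s).
  have uws : (index u s < index w s)%N.
    have [ws|ws] := boolP (w \in s); first by rewrite -!index_in.
    by rewrite (memNindex ws) index_mem.
  have [uv _] : ctime p u <= ctime p v /\ proc p v (ctime p u) <= (p u)%:num.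
    by apply: run; rewrite (memNindex vs) index_mem.
  by have [] := run u w uws; split=> //; exact: pqs.
have uv : u = v.
  apply/eqP/negPn/negP => /(index_out _ us) ui; move: uw; rewrite ui ltnNge.
  by move=> /negP; apply; rewrite -(size_rcons s v) index_size.
have ws : w \notin s.
  apply/negP => ws; move: uw; rewrite uv index_v index_in// ltnNge => /negP; apply.
  by rewrite index_size.
rewrite uv; split=> //; first exact: vmin.
(* In the [p] run [v] and [w] still look alike, and [w] has not passed its own completion when [v]
   completes. *)
have pvw : p v = p w by rewrite /p /ranked_requirements !memNindex.
apply: le_trans (processed_mono p _ (nc_feasible A p) w _ _ (cp0 v) (vmin _ ws)) _.
by rewrite pvw; exact: processed_completion_le (nc_feasible A p) noprec w.
Qed.

(** Each round appends the task outside [s] that completes first under the current requirements. *)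
Lemma ranked_run_exists (n : nat) : (n <= #|task I|)%N ->
  exists s : seq (task I), [/\ uniq s, size s = n & ranked_run s].
Proof.
elim: n => [_|n IHn lt_n]; first by exists [::].
have [s [us sn run]] := IHn (ltnW lt_n).
have /existsP[v0 v0s] : [exists v, v \notin s].
  rewrite -negb_forall; apply/negP => /forallP all_s.
  move: lt_n; rewrite -sn -(card_uniqP us) ltnNge => /negP; apply.
  by apply: subset_leq_card; apply/fintype.subsetP => v _; exact: all_s.
case: (@arg_minP _ _ _ v0 [pred v | v \notin s]
  (ctime (ranked_requirements s)) v0s) => v /= vs vmin.
exists (rcons s v); rewrite rcons_uniq vs us size_rcons sn; split=> //.
exact: ranked_run_rcons.
Qed.

End Adversary.

(** * An instance with geometrically decreasing speeds *)

Section LowerBound.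
Context {R : realType}.

(** With indices counted from 0, speed [2^-j] belongs to the [3 * 4^j] indices from [4^j - 1] to
    [4^(j+1) - 2]. *)
Definition spread_speed (n : nat) : R := 2^-1 ^+ trunc_log 4 n.+1.

Lemma spread_speed_gt0 n : 0 < spread_speed n.
Proof. by rewrite exprn_gt0. Qed.

Lemma spread_speed_ge0 n : 0 <= spread_speed n.
Proof. exact: ltW (spread_speed_gt0 n). Qed.

Lemma spread_speedE j n : (4 ^ j <= n.+1 < 4 ^ j.+1)%N ->
  spread_speed n = 2^-1 ^+ j.
Proof. by move=> h; rewrite /spread_speed (trunc_log_eq _ h). Qed.

Lemma spread_speed_anti i j : (i <= j)%N -> spread_speed j <= spread_speed i.
Proof.
move=> ij; rewrite /spread_speed ler_wiXn2l ?invr_ge0 ?invf_le1 ?ler1n//.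
by apply: leq_trunc_log; rewrite ltnS.
Qed.

Lemma sum_spread_speed_le j : \sum_(i < (4 ^ j).-1) spread_speed i <= 3 * 2 ^+ j.
Proof.
elim: j => [|j IHj]; first by rewrite big_ord0 mulr_ge0.
have j0 : (0 < 4 ^ j)%N by rewrite expn_gt0.
have e4 : (4 ^ j.+1 = 4 * 4 ^ j)%N by rewrite expnS.
rewrite -(big_mkord predT) (@big_cat_nat _ _ _ (4 ^ j).-1)//=; last by lia.
(* The earlier classes take one copy of [3 * 2^j] by induction; class [j] contributes exactly
   another. *)
rewrite big_mkord exprS mulrCA mulr2n mulrDl mul1r lerD//.
rewrite (@eq_big_nat _ _ _ _ _ _ (fun=> 2^-1 ^+ j)); last first.
  by move=> i ij; apply: spread_speedE; lia.
rewrite sumr_const_nat (_ : (_ - _ = 3 * 4 ^ j)%N); last by lia.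
rewrite -[leLHS]mulr_natl natrM -mulrA natrX -exprMn.
by rewrite (_ : 4 / 2 = 2 :> R); [exact: lexx | by field].
Qed.

Variable m' : nat.
Let m := m'.+1.

Lemma spread_acyclic (s : seq 'I_m) : s != [::] -> ~~ cycle (fun _ _ => false) s.
Proof. by case: s => // x []. Qed.

Lemma spread_job (u v : 'I_m) : false -> tt = tt.
Proof. by []. Qed.

Definition spread_instance : instance R m :=
  @Instance R m (fun i => spread_speed i) (fun i => spread_speed_gt0 i)
    unit (fun=> 1) (fun=> ler01) 'I_m (fun=> tt) (fun _ _ => false)
    spread_acyclic spread_job.

Let I := spread_instance.

Lemma spread_noprec (u v : task I) : ~~ prec u v.
Proof. by []. Qed.

Lemma spread_objectiveE (p : requirements I) (S : schedule I) :
  objective p S = \big[maxe/0%E]_v completion p S v.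
Proof.
rewrite /objective (bigD1 (tt : job I))//= big1; last by case.
by rewrite adde0 mul1e; apply: eq_bigl => v; rewrite eqxx.
Qed.

Lemma spread_objective_ge0 (p : requirements I) (S : schedule I) :
  (0 <= objective p S)%E.
Proof.
rewrite spread_objectiveE; elim/big_ind: _ => // [x y x0 y0|v _].
  by rewrite le_max x0.
exact: completion_ge0.
Qed.

(** Running each [v] on machine [f v], whose speed equals its requirement, finishes everything by
    time 1. *)
Lemma opt_le1 (p : requirements I) (f g : 'I_m -> 'I_m) :
  cancel f g -> cancel g f -> (forall v, (p v)%:num = spread_speed (f v)) ->
  (0 <= opt p <= 1)%E.
Proof.
move=> fK gK pE.
pose S : schedule I := fun _ i => Some (g i).
have runE i v t : run_times S i v t = if g i == v then [set` `[0, t]%R] else set0.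
  apply/seteqP; case: ifPn => [/eqP gv|gv]; split=> x //=.
  - by rewrite in_itv/= => -[].
  - by rewrite in_itv/= => x0t; split=> //; rewrite /S gv.
  - by move=> [_ [/eqP]]; rewrite (negbTE gv).
have done v : finished p S v 1.
  apply/(finishedE p S spread_noprec).
  rewrite /processed (bigD1 (f v))//= runE fK eqxx lebesgue_measure_itv/=.
  rewrite lte_fin ltr01 /= oppr0 addr0 mulr1 pE lerDl; apply: sumr_ge0 => i _.
  by rewrite mulr_ge0 ?spread_speed_ge0 ?fine_ge0.
have le1 v : (completion p S v <= 1)%E.
  by apply: ereal_inf_lbound; exists 1.
have feas : feasible p S.
  split.
  - move=> i v t; rewrite runE.
    by case: ifP => _; [exact: measurable_itv | exact: measurable0].
  - by move=> t i i' v _ [gi] [gi']; apply: (can_inj gK); rewrite gi.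
  - by [].
  - by move=> v; exact: le_lt_trans (le1 v) (ltry 1).
apply/andP; split.
  by apply: le_ereal_inf_tmp => _ [S' _ <-]; exact: spread_objective_ge0.
apply: (@le_trans _ _ (objective p S)); first by apply: ereal_inf_lbound; exists S.
by rewrite spread_objectiveE; apply: bigmax_le.
Qed.

(** * The adversary on this instance *)

Variable A : nc_algorithm R m.

Let ctime (p : requirements I) v := completion_time p (A I p) v.

(** [f] is the reversed completion order: the last task to complete has rank 0 and the largest
    requirement. *)
Lemma adversarial_requirements : exists (p : requirements I) (f g : 'I_m -> 'I_m),
  [/\ cancel f g, cancel g f, forall v, (p v)%:num = spread_speed (f v) &
    forall u w : 'I_m, (f w < f u)%N -> ctime p u <= ctime p w /\
      processed (A I p) w (ctime p u) <= (p u)%:num].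
Proof.
(* The task at position [i] of the completion order takes the speed at position [i] from the slow
   end; truncated subtraction keeps [a] monotone past [m]. *)
pose a i := NngNum (spread_speed_ge0 (m - i.+1)).
have a_mono i j : (i <= j)%N -> (a i)%:num <= (a j)%:num.
  by move=> ij /=; apply: spread_speed_anti; lia.
have [|s [us sm run]] := ranked_run_exists A spread_noprec a a_mono m.
  by rewrite card_ord.
have mem_s v : v \in s.
  have /(uniq_min_size us)[|_ ->] : {subset s <= enum 'I_m}.
  - by move=> x _; rewrite mem_enum.
  - by rewrite size_enum_ord sm.
  - by rewrite mem_enum.
have lt_index v : (index v s < m)%N by have := index_mem v s; rewrite mem_s sm.
pose f v := rev_ord (Ordinal (lt_index v)).
have f_inj : injective f.
  move=> u v /rev_ord_inj /(congr1 val)/= uv.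
  by rewrite -[u](nth_index u (mem_s u)) uv nth_index.
have [g fK gK] := injF_bij f_inj.
exists (ranked_requirements a s), f, g; split=> // u w fuw.
apply: run; move: fuw => /=.
have := lt_index u; have := lt_index w; lia.
Qed.

Lemma adversarial_objective (k : nat) : (4 ^ k <= m)%N ->
  exists p : requirements I,
    (0 <= opt p <= 1)%E /\ ((k%:R / 5)%:E <= objective p (A I p))%E.
Proof.
move=> km; have [p [f [g [fK gK pE run]]]] := adversarial_requirements.
exists p; split; first exact: opt_le1 fK gK pE.
have feas := nc_feasible A p.
pose gi n := g (inord n).
have fgi n : (n < m)%N -> f (gi n) = n :> nat by move=> nm; rewrite gK inordK.
have ct0 v : 0 <= ctime p v by exact: completion_time_ge0.
(* [gi 0] is last in the completion order and [gi (4 ^ k).-1] is last among size [2^-k]; [k] phases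
   of length at least 1/5 lie between them. *)
suff H : k%:R / 5 + ctime p (gi (4 ^ k).-1) <= ctime p (gi 0).
  rewrite spread_objectiveE; apply: (bigmax_sup (gi 0 : task I)) => //.
  rewrite (completion_timeE p _ feas) lee_fin; apply: le_trans H.
  by rewrite lerDl.
elim: k km => [_|k IHk km]; first by rewrite mul0r add0r.
have j0 : (0 < 4 ^ k)%N by rewrite expn_gt0.
have e4 : (4 ^ k.+1 = 4 * 4 ^ k)%N by rewrite expnS.
have {}IHk : k%:R / 5 + ctime p (gi (4 ^ k).-1) <= ctime p (gi 0).
  by apply: IHk; lia.
apply: le_trans IHk.
set u := gi (4 ^ k.+1).-1; set w := gi (4 ^ k).-1.
have fu : f u = (4 ^ k.+1).-1 :> nat by rewrite fgi//; lia.
have fw : f w = (4 ^ k).-1 :> nat by rewrite fgi//; lia.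
suff : 1 / 5 <= ctime p w - ctime p u by rewrite -natr1; lra.
have uw : ctime p u <= ctime p w by apply: (run u w _).1; rewrite fu fw; lia.
(* These are all the tasks of size [2^-k], with [w] last among them; [u] is last among the tasks of
   half that size. *)
pose x i := gi ((4 ^ k).-1 + i)%N.
have fx (i : 'I_(3 * 4 ^ k)) : f (x i) = ((4 ^ k).-1 + i)%N :> nat.
  by rewrite fgi//; have := ltn_ord i; lia.
pose L : {set task I} := [set x i | i : 'I_(3 * 4 ^ k)]%SET.
have cardL : #|L| = (3 * 4 ^ k)%N.
  rewrite card_imset ?card_ord// => i i' /(congr1 (fun y => val (f y))) /=.
  by rewrite !fx => /addnI /val_inj.
(* The machines of speed at least [2^-k]. *)
pose H : {set 'I_m} := [set i : 'I_m | (i < (4 ^ k.+1).-1)%N]%SET.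
pose h : R := 2^-1 ^+ k.
have h0 : 0 <= h / 2 by rewrite divr_ge0// exprn_ge0.
have slow (i : 'I_m) : i \notin H -> speed I i <= h / 2.
  rewrite inE -leqNgt => hi.
  apply: le_trans (spread_speed_anti _ _ hi) _.
  by rewrite (spread_speedE k.+1) ?exprSr// e4 expnS; lia.
have aab : 0 <= ctime p u <= ctime p w by rewrite ct0.
have := processed_capacity p _ feas L H _ _ _ aab h0 slow.
(* When [u] completes, a task of [L] has received at most the requirement [h / 2] of [u]; when [w]
   completes, it has received all of [h]. *)
have volume v : v \in L ->
    h / 2 <= processed (A I p) v (ctime p w) - processed (A I p) v (ctime p u).
  move=> /imsetP[i _ ->].
  have pw : (p (x i))%:num = h.
    by rewrite pE (spread_speedE k)// fx; have := ltn_ord i; lia.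
  have : processed (A I p) (x i) (ctime p u) <= h / 2.
    have [|_] := run u (x i); first by rewrite fu fx; have := ltn_ord i; lia.
    by rewrite pE (spread_speedE k.+1) ?exprSr// fu e4 expnS; lia.
  have : h <= processed (A I p) (x i) (ctime p w).
    rewrite -pw -(completion_time_leE p _ feas spread_noprec)//.
    have [i0|i0] := posnP i; first by rewrite /x i0 addn0.
    by apply: (run _ _ _).1; rewrite fw fx; lia.
  lra.
have : #|L|%:R * (h / 2) <= \sum_(v in L)
    (processed (A I p) v (ctime p w) - processed (A I p) v (ctime p u)).
  by rewrite -sum1_card natr_sum mulr_suml ler_sum// => v vL; rewrite mul1r volume.
have fast : \sum_(i in H) speed I i <= 6 * 2 ^+ k.
  rewrite (eq_bigl (fun i : 'I_m => (i < (4 ^ k.+1).-1)%N)); last first.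
    by move=> i; rewrite inE.
  rewrite -(big_ord_widen _ (fun i => spread_speed i)); last by lia.
  by apply: le_trans (sum_spread_speed_le _) _; rewrite exprS; lra.
rewrite cardL natrM natrX.
have -> : 3 * 4 ^+ k * (h / 2) = 3 / 2 * 2 ^+ k :> R.
  rewrite (_ : 4 = 2 * 2) ?exprMn; last by lra.
  rewrite /h exprVn; have : (2 : R) ^+ k != 0 by rewrite expf_neq0.
  by move=> ?; field.
have z0 : 0 < (2 : R) ^+ k by rewrite exprn_gt0.
move: fast z0 uw; set z := 2 ^+ k.
set X := \sum_(i in H) _; set Y := \sum_(v in L) _.
move=> fast z0 uw YL YX.
(* Cancelling [z] leaves 3/2 against 15/2 times the phase length, whence 1/5. *)
have : 3 / 2 * z <= (ctime p w - ctime p u) * (6 * z + 3 / 2 * z).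
  apply: le_trans YL _; apply: le_trans YX _.
  by rewrite ler_wpM2l ?subr_ge0// lerD2r.
by rewrite -mulrDl mulrA ler_pM2r//; lra.
Qed.

(** Dividing by an optimum in [[0, 1]] does not lower the objective; this covers 0, whose inverse is
    [+oo]. *)
Lemma competitive_ratio_ge (k : nat) : (4 ^ k <= m)%N ->
  ((k%:R / 5)%:E <= competitive_ratio A)%E.
Proof.
move=> /adversarial_objective[p [/andP[opt0 opt1] obj]].
apply: (@le_trans _ _ (objective p (A I p) / opt p)%E); last first.
  by apply: ereal_sup_ubound; exists I, p.
rewrite -[leLHS]mule1; apply: lee_pmul => //.
by rewrite inve_ge1.
Qed.

End LowerBound.

(** * From the number of speed classes to the logarithmic bound *)

Theorem theorem6 (R : realType) :
  exists c : R, 0 < c /\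
  exists m0 : nat, forall m : nat, (m0 <= m)%N ->
  forall A : nc_algorithm R m,
    ((c * (ln m%:R / ln (ln m%:R)))%:E <= competitive_ratio A)%E.
Proof.
(* A factor 5 comes from the phase length and a factor 4 from [ln m <= 4 * k]. *)
exists 20^-1; split; first by rewrite invr_gt0.
(* From [e^e] on, [ln (ln m)] is at least 1, so dividing by it only weakens the bound; [m >= 4]
   gives [k >= 1]. *)
exists (Num.truncn (expR (expR 1 : R))).+4 => m hm A.
case: m hm A => [//|m'] hm A; set m := m'.+1 in hm A *.
have m4 : (4 <= m)%N by lia.
pose k := trunc_log 4 m.
have km : (4 ^ k <= m)%N by exact: trunc_logP.
apply: le_trans (competitive_ratio_ge _ A k km); rewrite lee_fin.
have k1 : 1 <= k%:R :> R by rewrite ler1n trunc_log_gt0.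
have m0 : 0 < m%:R :> R by rewrite ltr0n.
have big : expR (expR 1) <= m%:R :> R.
  apply: le_trans (ltW (truncnS_gt _)) _; rewrite ler_nat.
  by move: (Num.truncn _) hm => n; lia.
have lnm : expR 1 <= ln m%:R :> R.
  by rewrite -[leLHS]expRK ler_ln ?posrE ?expR_gt0.
have lnm0 : 0 < ln m%:R :> R by exact: lt_le_trans (expR_gt0 _) lnm.
have lnlnm : 1 <= ln (ln m%:R) :> R.
  by rewrite -[leLHS]expRK ler_ln ?posrE ?expR_gt0.
have ln2 : ln 2 <= 1 :> R.
  by rewrite -[leRHS]expRK ler_ln ?posrE ?expR_gt0// -[2]/(1 + 1) expR_ge1Dx.
have ln_le : ln m%:R <= 4 * k%:R :> R.
  (* Since [m < 4^(k+1)] and [ln 2 <= 1], [ln m] is at most [2 * (k + 1)], hence at most [4 * k] as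
     [k >= 1]. *)
  have : ln m%:R <= ln (2 ^+ (2 * k.+1)) :> R.
    rewrite ler_ln ?posrE ?exprn_gt0// -natrX ler_nat expnM.
    by rewrite ltnW// trunc_log_ltn.
  rewrite lnXn// -(mulr_natr (ln 2)) natrM -(natr1 k) => /le_trans; apply.
  have : ln 2 * (2 * (k%:R + 1)) <= 1 * (2 * (k%:R + 1)) :> R.
    by rewrite ler_wpM2r// mulr_ge0// addr_ge0.
  lra.
rewrite ler_pdivrMl//; apply: (@le_trans _ _ (ln m%:R)); last by lra.
by rewrite ler_pdivrMr ?(lt_le_trans ltr01)// ler_peMr// ltW.
Qed.
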